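(* Let $G=(V,E)$ be a multigraph with $n$ nodes and $m$ edges, let $\epsilon\in(0,1/2]$, and let $x\in\mathsf{ST}(G)$ be a rational vector with $Ax\le b$ for a matrix $A\in[0,1]^{k\times m}$ and a vector $b\in[1,\infty)^k$. Let $G'=(V,E')$ be the random subgraph of $G$ obtained by including each edge $e\in E$ independently with probability $\alpha_e:=\min\{1,\tfrac{36\log(k+m)}{\epsilon^2}x_e\}$. Then with high probability (i) $|E'|=O(n\ln(k+m)/\epsilon^2)$, and (ii) there exists $z\in\mathsf{ST}(G)$ whose support is contained in $E'$ and which satisfies $Az\le(1+3\epsilon)b$.
   Context: $\mathcal{T}(G)$ is the set of spanning trees of $G$, $\mathds{1}_T\in\{0,1\}^E$ is the characteristic vector of a tree $T$, and the spanning tree polytope $\mathsf{ST}(G)$ is the convex hull of $\{\mathds{1}_T : T\in\mathcal{T}(G)\}$. ''With high probability'' means with probability at least $1-1/\mathrm{poly}(k+m)$. *)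

(* Defs.v *)
From HB Require Import structures.
From mathcomp Require Import all_boot all_order all_algebra.
From mathcomp Require Import all_classical all_reals all_analysis.
Set Implicit Arguments. Unset Strict Implicit. Unset Printing Implicit Defensive.
Import Order.TTheory GRing.Theory Num.Theory.
Local Open Scope ring_scope.

Section Defs.
Variables (V E : finType) (ends : E -> V * V).

(* A multigraph G = (V, E): each edge e has endpoints ends e (parallel edges
   and loops allowed). *)

Definition adjT (T : {set E}) : rel V :=
  fun u v => [exists e in T, (ends e == (u, v)) || (ends e == (v, u))].

Definition connectedT (T : {set E}) : bool :=
  [forall u : V, forall v : V, connect (adjT T) u v].

(* (V,T) is acyclic: no edge of T lies on a cycle, i.e. removing any edge of T
   disconnects its endpoints (this excludes loops and parallel edges). *)
Definition acyclicT (T : {set E}) : bool :=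
  [forall e in T, ~~ connect (adjT (T :\ e)) (ends e).1 (ends e).2].

Definition spanning_tree (T : {set E}) : bool := connectedT T && acyclicT T.

Variable R : realType.

Definition indic (T : {set E}) : E -> R := fun e => (e \in T)%:R.

Definition in_ST (x : E -> R) : Prop :=
  exists lam : {set E} -> R,
    [/\ forall T, 0 <= lam T,
        forall T, ~~ spanning_tree T -> lam T = 0,
        \sum_(T : {set E}) lam T = 1
      & forall e, x e = \sum_(T : {set E}) lam T * indic T e].

(* probability that the random edge set E' (each e included independently with
   probability alpha e) equals S *)
Definition incl_prob (alpha : E -> R) (S : {set E}) : R :=
  (\prod_(e in S) alpha e) * \prod_(e in ~: S) (1 - alpha e).

Definition Pr_sub (alpha : E -> R) (P : {set E} -> Prop) : R :=
  \sum_(S : {set E} | `[< P S >]) incl_prob alpha S.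

End Defs.

(* Main.v *)
Require Import Defs.
From HB Require Import structures.
From mathcomp Require Import all_boot all_order all_algebra.
From mathcomp Require Import all_classical all_reals all_analysis.
From mathcomp Require Import fintype finset ring lra.
Set Implicit Arguments. Unset Strict Implicit. Unset Printing Implicit Defensive.
Import Order.TTheory GRing.Theory Num.Theory.
Local Open Scope ring_scope.

(* Let K = 36 ln N / eps^2 and give a sampled edge e the weight max(1, K x_e),
   so that its expected weight is K x_e.  Chernoff bounds control the number of
   sampled edges and the rows of A.  For the cuts U, write x as a distribution
   on spanning trees: by Jensen the failure probabilities N^(-9/4 x(cut U)) sum
   to at most the average over trees T of the sum of N^(-9/4 |T :&: cut U|), and
   a cut is determined by its trace on T, so the sum is at most
   (1 + N^(-9/4))^m - 1.  Hence with high probability the sampled weights,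
   divided by K (1 - eps/2), are at least x on every cut.

   A vector y that is at least some x in ST(G) on every cut is above some
   z in ST(G): among the points of ST(G) supported on {y > 0} take z minimising
   the sum of z_e^2 / y_e, let s be the largest ratio z_e / y_e and F the set of
   edges where it is not attained.  By optimality and tree exchange every tree
   in the support of z spans the components of F inside F, so it has as few
   edges outside F as possible; therefore s y(~F) = z(~F) <= x(crossing F)
   <= y(crossing F) <= y(~F), where the middle step sums the cut inequality over
   the components of F.  Hence s <= 1. *)

(** * Connectivity, cuts and exchange of spanning tree edges *)

Section Connectivity.
Variables (V E : finType) (ends : E -> V * V).
Implicit Types (X Y T F : {set E}) (U : {set V}) (e f : E) (u v w : V).

Local Notation conn X := (connect (adjT ends X)).

Lemma adjT_sym X : symmetric (adjT ends X).
Proof. by move=> u v; apply: eq_existsb => e; rewrite orbC. Qed.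

Lemma conn_sym X u v : conn X u v = conn X v u.
Proof. exact/sym_connect_sym/adjT_sym. Qed.

Lemma conn_edge X e : e \in X -> conn X (ends e).1 (ends e).2.
Proof.
move=> eX; apply/connect1/existsP; exists e; rewrite eX /=.
by case: (ends e) => a b; rewrite eqxx.
Qed.

(** Stands in for path surgery: several later facts follow by exhibiting a function of the vertex
    that no edge of [X] changes. *)
Lemma conn_invariant (S : Type) X (g : V -> S) u v :
  (forall e, e \in X -> g (ends e).1 = g (ends e).2) ->
  conn X u v -> g u = g v.
Proof.
move=> gX /connectP[p pP ->]; elim: p u pP => //= w p IHp u /andP[uw /IHp<-].
case/existsP: uw => e /andP[eX]; have:= gX _ eX.
by case: (ends e) => a b /= gab /orP[]/eqP[<- <-].
Qed.

Lemma conn_sub X Y u v :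
  (forall e, e \in X -> conn Y (ends e).1 (ends e).2) ->
  conn X u v -> conn Y u v.
Proof.
move=> XY uv; suff <- : conn Y u u = conn Y u v by [].
apply: conn_invariant uv => e /XY eY.
by apply/idP/idP => /connect_trans; apply; rewrite // conn_sym.
Qed.

Lemma connS X Y u v : X \subset Y -> conn X u v -> conn Y u v.
Proof. by move=> /subsetP XY; apply: conn_sub => e /XY; apply: conn_edge. Qed.

Lemma conn_setU1 X f u v : conn (f |: X) u v ->
  [|| conn X u v, conn X u (ends f).1 && conn X (ends f).2 v
    | conn X u (ends f).2 && conn X (ends f).1 v].
Proof.
set a := (ends f).1; set b := (ends f).2 => uv.
(* The claim, read as a function of the end vertex, holds at [u] and is invariant along [f] and
   along every edge of [X]. *)
pose g w := [|| conn X u w, conn X u a && conn X b w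
              | conn X u b && conn X a w].
suff gE : g u = g v by rewrite -/(g v) -gE /g connect0.
apply: conn_invariant uv => e; rewrite in_setU1 => /predU1P[->|eX].
  rewrite -/a -/b /g !connect0 !andbT.
  by case: (conn X u a); case: (conn X u b).
have step c : conn X c (ends e).1 = conn X c (ends e).2.
  have eE := conn_edge eX; apply/idP/idP => /connect_trans; apply => //.
  by rewrite conn_sym.
by rewrite /g !step.
Qed.

Definition edge_cut U : {set E} :=
  [set e | ((ends e).1 \in U) != ((ends e).2 \in U)].

Definition comp_of X u : {set V} := [set v | conn X u v].

Lemma cut_comp_disjoint X u e : e \in X -> e \notin edge_cut (comp_of X u).
Proof.
move=> eX; rewrite inE negbK !inE; apply/eqP.
have eE := conn_edge eX; apply/idP/idP => /connect_trans; apply => //.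
by rewrite conn_sym.
Qed.

Lemma connected_cut T U u v : connectedT ends T -> u \in U -> v \notin U ->
  exists2 e, e \in T & e \in edge_cut U.
Proof.
move=> /forallP/(_ u)/forallP/(_ v) uv uU vU.
have [/existsP[e /andP[eT eU]]|no] := boolP [exists e in T, e \in edge_cut U].
  by exists e.
case/negP: vU; rewrite -(@conn_invariant _ T (fun w => w \in U) u v) //.
move=> e eT; apply: contraNeq no => eU; apply/existsP; exists e.
by rewrite eT inE.
Qed.

(** Equal traces on [T] make membership in exactly one of [U1], [U2] constant along tree edges, and
    it is false at [r]. Fixing [r] outside separates a set from its complement, which has the same
    cut. *)
Lemma cut_cap_inj T r U1 U2 : connectedT ends T -> r \notin U1 ->
  r \notin U2 -> T :&: edge_cut U1 = T :&: edge_cut U2 -> U1 = U2.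
Proof.
move=> /forallP/(_ r)/forallP Tr r1 r2 eqT; apply/setP => v.
have : (r \in U1) (+) (r \in U2) = (v \in U1) (+) (v \in U2).
  apply: (@conn_invariant _ T (fun w => (w \in U1) (+) (w \in U2))) (Tr v).
  move=> e eT; move/setP/(_ e): eqT; rewrite !inE eT /=.
  by do 4!case: (_ \in _).
by rewrite (negPf r1) (negPf r2); do 2!case: (_ \in _).
Qed.

(** An inclusion-minimal connected subset of [X] is acyclic, since an edge whose ends stay joined
    without it could be dropped. *)
Lemma exists_spanning_tree X : connectedT ends X ->
  exists2 T, spanning_tree ends T & T \subset X.
Proof.
move=> cX; have [T /minsetP[cT minT] TX] := minset_exists cX.
exists T => //; rewrite /spanning_tree cT; apply/forallP => e.
apply/implyP => eT; apply/negP => ce.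
have /minT/(_ (subsetDl _ _)) : connectedT ends (T :\ e).
  apply/forallP => u; apply/forallP => v.
  move/forallP/(_ u)/forallP/(_ v): cT; apply: conn_sub => f fT.
  by have [->|fe] := eqVneq f e; last by apply: conn_edge; rewrite !inE fe.
by move/setP/(_ e); rewrite !inE eqxx eT.
Qed.

(* The edge [f] is taken on the tree path between the ends of [e], which must
   leave [F]. *)
Lemma spanning_tree_exchange T F e : spanning_tree ends T -> e \in F ->
  ~~ conn (T :&: F) (ends e).1 (ends e).2 ->
  exists f, [/\ f \in T, f \notin F, e \notin T &
                spanning_tree ends (e |: (T :\ f))].
Proof.
set u := (ends e).1; set v := (ends e).2.
move=> /andP[cT aT] eF nuv.
have eT : e \notin T.
  by apply: contra nuv => eT; apply: conn_edge; rewrite inE eT.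
have Tuv : conn T u v by move/forallP/(_ u)/forallP/(_ v): cT.
(* The tree path is encoded as a minimal subset of [T] joining [u] to [v]; it cannot lie inside
   [F]. *)
have [X /minsetP[Xuv minX] XT] :=
  @minset_exists _ (fun X => conn X u v) _ Tuv.
have [f fX fF] : exists2 f, f \in X & f \notin F.
  apply/exists_inP; apply: contraR nuv => /exists_inPn XF.
  by apply: connS Xuv; rewrite subsetI XT; apply/subsetP => g /XF; rewrite negbK.
have fT := subsetP XT _ fX; set a := (ends f).1; set b := (ends f).2.
have nab : ~~ conn (T :\ f) a b by move/forallP/(_ f): aT; rewrite fT.
have XTf : X :\ f \subset T :\ f by exact: setSD.
have nuvf : ~~ conn (X :\ f) u v.
  apply/negP => /minX/(_ (subsetDl _ _))/setP/(_ f).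
  by rewrite !inE eqxx fX.
have through : conn (T :\ f) u a && conn (T :\ f) b v
            || conn (T :\ f) u b && conn (T :\ f) a v.
  have : conn (f |: (X :\ f)) u v by rewrite setD1K.
  move/conn_setU1; rewrite (negPf nuvf) /= => /orP[]/andP[/(connS XTf)->].
    by move/(connS XTf)->.
  by move/(connS XTf)->; rewrite orbT.
have nTuv : ~~ conn (T :\ f) u v.
  apply: contra nab => uv; case/orP: through => /andP[h1 h2].
    apply: connect_trans (_ : conn (T :\ f) a v) _; last by rewrite conn_sym.
    by apply: connect_trans uv; rewrite conn_sym.
  apply: connect_trans h2 _; apply: connect_trans h1; by rewrite conn_sym.
exists f; split=> //; apply/andP; split.
  have sT : T :\ f \subset e |: (T :\ f) by apply: subsetUr.
  have e' : conn (e |: T :\ f) u v by apply: conn_edge; rewrite setU11.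
  apply/forallP => p; apply/forallP => q.
  move/forallP/(_ p)/forallP/(_ q): cT; apply: conn_sub => g gT.
  have [->|gf] := eqVneq g f; last first.
    by apply: conn_edge; rewrite !inE gf gT orbT.
  case/orP: through => /andP[/(connS sT) h1 /(connS sT) h2].
    apply: connect_trans (_ : conn (e |: T :\ f) a u) _.
      by rewrite conn_sym.
    by apply: connect_trans e' _; rewrite conn_sym.
  apply: connect_trans h2 _; rewrite conn_sym; apply: connect_trans e'.
  by rewrite conn_sym.
(* Acyclicity: the ends of [e] are separated in [T :\ f]. For another edge [g], a link avoiding [e]
   contradicts acyclicity of [T], and a link through [e] would join [u] to [v] in [T :\ f]. *)
apply/forallP => g; apply/implyP; rewrite in_setU1 => /predU1P[->|].
  apply: contra nTuv; apply: connS; apply/subsetP => h.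
  by rewrite !inE; case: (h == e).
rewrite !inE => /andP[gf gT]; apply/negP.
have ge : g != e by apply: contraNneq eT => <-.
have -> : (e |: T :\ f) :\ g = e |: (T :\ f :\ g).
  by apply/setP => h; rewrite !inE; have [->|] := eqVneq h e; rewrite ?[e == g]eq_sym ?ge.
have sg : T :\ f :\ g \subset T :\ f by exact: subsetDl.
have gE : conn (T :\ f) (ends g).1 (ends g).2.
  by apply: conn_edge; rewrite !inE gf gT.
move/conn_setU1/or3P => [h|/andP[h1 h2]|/andP[h1 h2]].
- move/forallP/(_ g): aT; rewrite gT => /negP; apply; apply: connS h.
  by apply: setSD; apply: subsetDl.
- case/negP: nTuv; move/(connS sg): h1 => h1; move/(connS sg): h2 => h2.
  rewrite conn_sym in h1; apply: connect_trans h1 _.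
  by apply: connect_trans gE _; rewrite conn_sym.
- case/negP: nTuv; move/(connS sg): h1 => h1; move/(connS sg): h2 => h2.
  by apply: connect_trans h2 _; apply: connect_trans h1; rewrite conn_sym.
Qed.

End Connectivity.

(** * Sizes of forests through the rank of the incidence matrix *)

Section Forests.
Variables (V E : finType) (ends : E -> V * V).
Implicit Types (I J : {set E}).

Local Notation conn X := (connect (adjT ends X)).

Lemma acyclicTS I J : J \subset I -> acyclicT ends I -> acyclicT ends J.
Proof.
move=> JI /forallP aI; apply/forallP => e; apply/implyP => eJ.
move/implyP/(_ (subsetP JI _ eJ)): (aI e); apply: contra.
by apply: connS; apply: setSD.
Qed.

Definition vertex_vec (v : V) : 'rV[rat]_#|V| := delta_mx 0 (enum_rank v).

Definition edge_vec (e : E) := vertex_vec (ends e).1 - vertex_vec (ends e).2.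

Definition incidence_mx I : 'M[rat]_(#|I|, #|V|) :=
  \matrix_(i < #|I|) edge_vec (enum_val i).

(* Deleting [e] from a forest leaves a component whose indicator vector is
   orthogonal to every other edge but not to [e]. *)
Lemma forest_row_free J : acyclicT ends J -> row_free (incidence_mx J).
Proof.
move=> aJ; apply: inj_row_free => c cJ0; apply/rowP => i; rewrite mxE.
set e := enum_val i; have eJ : e \in J := enum_valP i.
pose S := comp_of ends (J :\ e) (ends e).1.
pose chi : 'cV[rat]_#|V| := \col_j (enum_val j \in S)%:R.
have chiE v : (vertex_vec v *m chi) 0 0 = (v \in S)%:R.
  by rewrite -rowE !mxE enum_rankK.
have JchiE j : (incidence_mx J *m chi) j 0 = (j == i)%:R.
  have -> : (incidence_mx J *m chi) j 0 = (edge_vec (enum_val j) *m chi) 0 0.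
    by rewrite -(rowK (fun j => edge_vec (enum_val j))) -row_mul !mxE.
  have -> : (edge_vec (enum_val j) *m chi) 0 0
    = (vertex_vec (ends (enum_val j)).1 *m chi) 0 0
      - (vertex_vec (ends (enum_val j)).2 *m chi) 0 0.
    by rewrite mulmxBl !mxE.
  rewrite !chiE.
  have [->|ji] := eqVneq j i.
    rewrite -/e !inE connect0; move/forallP/(_ e): aJ; rewrite eJ /=.
    by move=> /negPf->; rewrite subr0.
  have : enum_val j \notin edge_cut ends S.
    apply: cut_comp_disjoint; rewrite !inE enum_valP andbT.
    by rewrite (inj_eq enum_val_inj).
  by rewrite inE negbK => /eqP->; rewrite subrr.
have /matrixP/(_ 0 0) : c *m incidence_mx J *m chi = 0 by rewrite cJ0 mul0mx.
rewrite -mulmxA mxE (bigD1 i) //= big1 => [|j ji].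
  by rewrite JchiE eqxx mulr1 addr0 mxE.
by rewrite JchiE (negPf ji) mulr0.
Qed.

(** Edge vectors telescope along a path from [u] to [v]; changing [w] across an edge alters the
    difference by an element of the row space. *)
Lemma conn_sub_incidence I u v : conn I u v ->
  (vertex_vec u - vertex_vec v <= incidence_mx I)%MS.
Proof.
move=> uv; pose g w := (vertex_vec u - vertex_vec w <= incidence_mx I)%MS.
suff gE : g u = g v by rewrite -/(g v) -gE /g subrr sub0mx.
apply: conn_invariant uv => e eI.
have eS : (edge_vec e <= incidence_mx I)%MS.
  have <- : row (enum_rank_in eI e) (incidence_mx I) = edge_vec e.
    by rewrite rowK enum_rankK_in.
  exact: row_sub.
rewrite /g; apply/idP/idP => h.
  have -> : vertex_vec u - vertex_vec (ends e).2
    = (vertex_vec u - vertex_vec (ends e).1) + edge_vec e.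
    by rewrite /edge_vec addrA subrK.
  exact: addmx_sub.
have -> : vertex_vec u - vertex_vec (ends e).1
  = (vertex_vec u - vertex_vec (ends e).2) - edge_vec e.
  by rewrite /edge_vec opprB addrA subrK.
by apply: addmx_sub => //; rewrite eqmx_opp.
Qed.

(** The rows of [J] are independent and lie in the row space of [I], so the bound is a comparison of
    ranks. *)
Lemma forest_card_le I J : acyclicT ends J ->
  (forall e, e \in J -> conn I (ends e).1 (ends e).2) -> (#|J| <= #|I|)%N.
Proof.
move=> /forest_row_free/eqP<- JI; apply: leq_trans (rank_leq_row (incidence_mx I)).
apply: mxrankS; apply/row_subP => i; rewrite rowK.
exact/conn_sub_incidence/JI/enum_valP.
Qed.

Lemma forest_card_leV J : acyclicT ends J -> (#|J| <= #|V|)%N.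
Proof. by move=> /forest_row_free/eqP<-; apply: rank_leq_col. Qed.

End Forests.

(** * Minimising a quadratic form over distributions with prescribed support *)

Section SimplexMinimum.
Import numFieldNormedType.Exports.
Variables (R : realType) (I E : finType).

Definition supported_distr (Q : pred I) (lam : I -> R) :=
  [/\ forall i, 0 <= lam i, forall i, ~~ Q i -> lam i = 0 & \sum_i lam i = 1].

Definition marginal (M : I -> E -> R) (lam : I -> R) (e : E) : R :=
  \sum_i lam i * M i e.

(** Extreme value theorem: the admissible distributions form a compact set and the form is
    continuous. *)
Lemma quadratic_minimizer (Q : pred I) (c : E -> R) (M : I -> E -> R) (i0 : I) :
  Q i0 -> exists2 lam, supported_distr Q lam &
    forall mu, supported_distr Q mu ->
      \sum_e c e * marginal M lam e ^+ 2 <= \sum_e c e * marginal M mu e ^+ 2.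
Proof.
move=> Qi0; pose n := #|I|.
pose lam (v : 'rV[R]_n) (i : I) : R := v ord0 (enum_rank i).
pose Phi v := \sum_e c e * marginal M (lam v) e ^+ 2.
(* Coordinates outside [Q] get the degenerate interval from 0 to 0, which encodes the support
   condition. *)
pose box : set 'rV[R]_n :=
  [set v : 'rV[R]_n | forall j, `[0, (Q (enum_val j))%:R]%classic (v ord0 j)]%classic.
pose plane : set 'rV[R]_n := ((fun v => \sum_i lam v i) @^-1` [set 1])%classic.
have lamc i : continuous (fun v : 'rV[R]_n => lam v i : R) by exact: coord_continuous.
have sumc (J : finType) (g : J -> 'rV[R]_n -> R) : (forall j, continuous (g j : 'rV[R]_n -> R)) ->
  continuous (fun v : 'rV[R]_n => \sum_j g j v : R).
  by move=> gc; apply: continuous_big => // -[a b]; exact: add_continuous.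
have mulc (f g : 'rV[R]_n -> R) : continuous f -> continuous g ->
  continuous (fun v => f v * g v).
  by move=> fc gc v; apply: (@continuousM _ _ f g); [exact: fc | exact: gc].
have boxplane v : (box `&` plane)%classic v <-> supported_distr Q (lam v).
  split=> [[bv pv]|[l0 lQ l1]].
    split=> // i; have := bv (enum_rank i); rewrite /= in_itv /= enum_rankK.
      by case/andP.
    by move=> /[swap] /negPf-> h; apply/eqP; rewrite eq_le andbC.
  split=> // j; rewrite /= in_itv /=.
  have -> : v ord0 j = lam v (enum_val j) by rewrite /lam enum_valK.
  rewrite l0 /=; have [_|/lQ->//] := boolP (Q _).
  rewrite -l1 (bigD1 (enum_val j)) //= lerDl; exact: sumr_ge0.
pose row mu : 'rV[R]_n := \row_j mu (enum_val j).
have lam_row mu : lam (row mu) = mu.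
  by apply/funext => i; rewrite /lam mxE enum_rankK.
have ne : (box `&` plane !=set0)%classic.
  exists (row (fun i => (i == i0)%:R)); apply/boxplane; rewrite lam_row; split.
  - by move=> i; rewrite ler0n.
  - by move=> i; apply: contraNeq; rewrite pnatr_eq0 eqb0 negbK => /eqP->.
  - by rewrite (bigD1 i0) //= eqxx big1 ?addr0 // => i /negPf->.
have cpt : compact (box `&` plane)%classic.
  apply: compact_closedI.
    apply: (@rV_compact R n (fun j => `[0, (Q (enum_val j))%:R]%classic : set R)).
    by move=> j; exact: segment_compact.
  apply: (@preimage_closed 'rV[R]_n R (fun v => \sum_i lam v i)).
    by move=> v _; apply: sumc.
  exact: closed_eq.
have Phic : continuous Phi.
  apply: (sumc) => e; apply: (mulc); first by move=> v; exact: cst_continuous.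
  have mc : continuous (fun v : 'rV[R]_n => marginal M (lam v) e : R).
    by apply: sumc => i; apply: (mulc) => // v; exact: cst_continuous.
  exact: mulc.
have [v /set_mem/boxplane vP vmin] :=
  compact_EVT_min ne cpt (continuous_subspaceT Phic).
exists (lam v) => // mu muP; have := vmin (row mu).
by rewrite /Phi lam_row; apply; apply/mem_set/boxplane; rewrite lam_row.
Qed.

End SimplexMinimum.

(** * Vectors dominating a polytope point on all cuts lie above a polytope point *)

Section CutDomination.
Variables (R : realType) (V E : finType) (ends : E -> V * V).
Implicit Types (T F C : {set E}) (U : {set V}) (e f : E).

Local Notation conn X := (connect (adjT ends X)).
Local Notation tree_marginal := (marginal (@Defs.indic E R)).

Lemma in_STP (x : E -> R) : in_ST ends x <->
  exists2 lam, supported_distr (spanning_tree ends) lam & x =1 tree_marginal lam.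
Proof.
by split=> [[lam []]|[lam []]]; exists lam.
Qed.

Lemma in_ST_ge0 (x : E -> R) e : in_ST ends x -> 0 <= x e.
Proof.
move=> /in_STP[lam [lam0 _ _] ->]; apply: sumr_ge0 => T _.
by apply: mulr_ge0; rewrite // ler0n.
Qed.

(** Linearity of expectation: the weight of [C] is the mean number of edges of a random tree in
    [C]. *)
Lemma marginal_sum (lam : {set E} -> R) C :
  \sum_(e in C) tree_marginal lam e = \sum_T lam T * #|T :&: C|%:R.
Proof.
rewrite exchange_big; apply: eq_bigr => T _; rewrite -mulr_sumr; congr (_ * _).
rewrite -natr_sum -sum1_card; congr _%:R.
rewrite big_mkcond [RHS]big_mkcond; apply: eq_bigr => e _.
by rewrite inE; case: (e \in C); case: (e \in T).
Qed.

Lemma swap_quadratic (c z : E -> R) e f (t : R) : e != f ->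
  \sum_g c g * (z g + t * ((g == e)%:R - (g == f)%:R)) ^+ 2 =
  \sum_g c g * z g ^+ 2 + t * (2 * (c e * z e - c f * z f) + t * (c e + c f)).
Proof.
move=> ef; have fe : f == e = false by rewrite eq_sym; apply: negPf.
rewrite (bigD1 e) // (bigD1 f) ?fe //= [in RHS](bigD1 e) // [in RHS](bigD1 f) ?fe //=.
rewrite !eqxx (negPf ef) /= mulr1n mulr0n.
under eq_bigr => g /andP[/negPf-> /negPf->] do rewrite subrr mulr0 addr0.
by ring.
Qed.

(* Otherwise moving a little mass from [T] to [T] with [f] exchanged for [e]
   would decrease the quadratic form. *)
Lemma minimizer_no_swap (Q : pred {set E}) (c : E -> R) lam T e f :
  supported_distr Q lam ->
  (forall mu, supported_distr Q mu ->
     \sum_g c g * tree_marginal lam g ^+ 2 <= \sum_g c g * tree_marginal mu g ^+ 2) ->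
  lam T != 0 -> e \notin T -> f \in T -> Q T -> Q (e |: (T :\ f)) ->
  0 < c e -> 0 < c f ->
  c f * tree_marginal lam f <= c e * tree_marginal lam e.
Proof.
set z := tree_marginal lam => -[lam0 lamQ lam1] lamin lamT eT fT QT QT' ce cf.
rewrite leNgt; apply/negP => lt_ef.
have lamTgt0 : 0 < lam T by rewrite lt_def lamT lam0.
have ef : e != f by apply: contraNneq eT => ->.
set T' := e |: (T :\ f) in QT' *.
have TT' : T' != T by apply: contraNneq eT => <-; rewrite setU11.
(* The first bound keeps the mass at [T] nonnegative; the second makes the quadratic term at most
   half the linear gain, so the form strictly decreases. *)
pose t := Num.min (lam T) ((c f * z f - c e * z e) / (c e + c f)).
have t0 : 0 < t by rewrite lt_min lamTgt0 divr_gt0 ?subr_gt0 ?addr_gt0.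
have tT : t <= lam T by rewrite ge_min lexx.
have tc : t * (c e + c f) <= c f * z f - c e * z e.
  by rewrite -ler_pdivlMr ?addr_gt0 // ge_min lexx orbT.
pose mu S := lam S + t * ((S == T')%:R - (S == T)%:R).
have sum_at (g : {set E} -> R) S : \sum_S' g S' * (S' == S)%:R = g S.
  rewrite (bigD1 S) //= eqxx mulr1 big1 ?addr0 // => S' /negPf->.
  by rewrite mulr0.
have muP : supported_distr Q mu.
  split=> [S|S QS|].
  - rewrite /mu; have [->|ST] := eqVneq S T.
      by rewrite eq_sym (negPf TT') sub0r mulrN1 subr_ge0.
    by rewrite subr0 addr_ge0 // mulr_ge0 ?ler0n // ltW.
  - rewrite /mu lamQ //; have /negPf-> : S != T' by apply: contraNneq QS => ->.
    have /negPf-> : S != T by apply: contraNneq QS => ->.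
    by rewrite subrr mulr0 addr0.
  - rewrite big_split /= lam1 -mulr_sumr sumrB.
    rewrite -[X in X - _](eq_bigr _ (fun _ _ => mul1r _)) sum_at.
    rewrite -[X in _ - X](eq_bigr _ (fun _ _ => mul1r _)) sum_at.
    by rewrite subrr mulr0 addr0.
have muE g : tree_marginal mu g = z g + t * ((g == e)%:R - (g == f)%:R).
  have -> : (g == e)%:R - (g == f)%:R = Defs.indic R T' g - Defs.indic R T g.
    rewrite /Defs.indic !inE; have [->|ge] := eqVneq g e.
      by rewrite (negPf ef) (negPf eT).
    have [->|gf] := eqVneq g f; first by rewrite fT.
    by rewrite /= !subrr.
  rewrite -(sum_at (fun S => Defs.indic R S g) T') -(sum_at (fun S => Defs.indic R S g) T).
  rewrite -sumrB mulr_sumr -big_split; apply: eq_bigr => S _ /=.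
  by rewrite /mu; ring.
have := lamin mu muP; rewrite -/z.
under [X in _ <= X]eq_bigr => g _ do rewrite muE.
rewrite swap_quadratic // lerDl pmulr_rge0 //; lra.
Qed.

Definition crossing F : {set E} :=
  [set e | ~~ conn F (ends e).1 (ends e).2].

Lemma comp_of_eq F u v : conn F u v -> comp_of ends F u = comp_of ends F v.
Proof.
move=> uv; apply/setP => w; rewrite !inE.
by apply/idP/idP => /(connect_trans _); apply; rewrite // conn_sym.
Qed.

(** An edge joining two components of [F] lies in exactly their two cuts; an edge within a component
    lies in none. *)
Lemma sum_comp_cuts F (y : E -> R) :
  \sum_(U in [set comp_of ends F v | v in V]) \sum_(e in edge_cut ends U) y e =
  2 * \sum_(e in crossing F) y e.
Proof.
rewrite mulr_sumr (exchange_big_dep predT) //= [RHS]big_mkcond /=.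
apply: eq_bigr => e _; rewrite sumr_const inE.
set a := (ends e).1; set b := (ends e).2.
have memP v w : (w \in comp_of ends F v) = conn F v w by rewrite inE.
have [ab|nab] := boolP (conn F a b); last first.
  rewrite [X in _ *+ X](_ : _ = 2%N) ?mulr_natl // -[RHS](_ : #|[set comp_of ends F a; comp_of ends F b]| = _).
    apply: eq_card => U; rewrite !inE; apply/andP/orP.
      case=> /imsetP[v _ ->]; rewrite !inE -/a -/b.
      have [va _|nva] := boolP (conn F v a).
        by left; apply/eqP/comp_of_eq.
      by have [vb _|] := boolP (conn F v b); [right; apply/eqP/comp_of_eq | ].
    case=> /eqP->; split; rewrite ?imset_f // !inE -/a -/b connect0.
      by rewrite (negPf nab).
    by rewrite conn_sym (negPf nab).
  rewrite cards2; case: eqVneq => // eqab; case/negP: nab.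
  by rewrite -memP eqab inE connect0.
rewrite [X in _ *+ X](_ : _ = 0%N) // ; apply: eq_card0 => U; rewrite !inE.
apply/negbTE/negP => /andP[/imsetP[v _ ->]]; rewrite !inE -/a -/b => /negP; apply.
by apply/eqP; apply/idP/idP => /connect_trans; apply; rewrite // conn_sym.
Qed.

Lemma spanning_tree_card T1 T2 : spanning_tree ends T1 -> spanning_tree ends T2 ->
  #|T1| = #|T2|.
Proof.
move=> /andP[/forallP c1 a1] /andP[/forallP c2 a2]; apply/eqP.
rewrite eqn_leq; apply/andP; split; apply: (forest_card_le (ends := ends)) => // e _.
  exact: (forallP (c2 _)).
exact: (forallP (c1 _)).
Qed.

(** [T :&: F] spans every component of [F], so it is at least as large as the forest
    [T1 :\: crossing F]. Since [T] and [T1] have equal size, the complements compare the other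
    way. *)
Lemma spanning_tree_card_setD T1 T F : spanning_tree ends T1 ->
  spanning_tree ends T ->
  (forall e, e \in F -> conn (T :&: F) (ends e).1 (ends e).2) ->
  (#|T :&: ~: F| <= #|T1 :&: crossing F|)%N.
Proof.
move=> sT1 sT spF; rewrite -setDE.
have le : (#|T1 :\: crossing F| <= #|T :&: F|)%N.
  apply: (@forest_card_le _ _ ends) => [|e].
    by case/andP: sT1 => _; apply: acyclicTS; apply: subsetDl.
  by rewrite !inE negbK => /andP[h _]; apply: conn_sub h.
have := spanning_tree_card sT1 sT.
rewrite -(cardsID (crossing F) T1) -(cardsID F T) => eqc.
by rewrite -(leq_add2l #|T :&: F|) -eqc addnC leq_add2r.
Qed.

Lemma in_ST_cut_ge1 (x : E -> R) U u v : in_ST ends x -> u \in U -> v \notin U ->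
  1 <= \sum_(e in edge_cut ends U) x e.
Proof.
move=> /in_STP[lam [lam0 lamQ lam1] xE] uU vU.
under eq_bigr => e _ do rewrite xE.
rewrite marginal_sum -[X in X <= _]lam1; apply: ler_sum => T _.
have [/andP[cT _]|/lamQ->] := boolP (spanning_tree ends T); last by rewrite mul0r.
have [e eT eU] := connected_cut cT uU vU.
rewrite ler_peMr // ler1n card_gt0; apply/set0Pn; exists e.
by rewrite inE eT.
Qed.

Lemma cut_dominated_in_ST (x y : E -> R) : in_ST ends x ->
  (forall e, 0 <= y e) ->
  (forall U, \sum_(e in edge_cut ends U) x e <= \sum_(e in edge_cut ends U) y e) ->
  exists2 z, in_ST ends z & forall e, z e <= y e.
Proof.
move=> xST y0 xy; pose D := [set e | 0 < y e].
have yD e : e \notin D -> y e = 0.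
  by rewrite inE -leNgt => ye; apply/eqP; rewrite eq_le ye y0.
(* A component of a disconnected [D] would have a cut of [y]-weight 0, although its [x]-weight is at
   least 1. *)
have cD : connectedT ends D.
  apply/forallP => u; apply/forallP => v; apply/negPn/negP => nuv.
  have := in_ST_cut_ge1 (U := comp_of ends D u) (u := u) (v := v) xST.
  rewrite !inE connect0 nuv => /(_ isT isT); apply/negP; rewrite -ltNge.
  apply: le_lt_trans (xy _) _; rewrite big1 // => e eU; apply: yD.
  by apply: contraTN eU; apply: cut_comp_disjoint.
have [T0 sT0 T0D] := exists_spanning_tree cD.
pose Q T := spanning_tree ends T && (T \subset D).
(* Where [y e] is 0 the coefficient is 0 by convention; this is harmless because the trees in [Q]
   avoid such edges. *)
have [|mu muP mumin] := @quadratic_minimizer R _ E Q (fun e => (y e)^-1) (@Defs.indic E R) T0.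
  by rewrite /Q sT0.
have [mu0 muQ mu1] := muP.
have muT T : mu T != 0 -> Q T by apply: contraNT => /muQ->.
set z := tree_marginal mu in mumin *.
have zD e : e \notin D -> z e = 0.
  move=> eD; apply: big1 => T _; have [->|/muT/andP[_ TD]] := eqVneq (mu T) 0.
    by rewrite mul0r.
  by rewrite /Defs.indic (negPf (contra (subsetP TD e) eD)) mulr0.
exists z.
  apply/in_STP; exists mu => //; split=> // T nT; apply: muQ.
  by rewrite /Q (negPf nT).
suff ratio_le1 e : e \in D -> (y e)^-1 * z e <= 1.
  move=> e; have [eD|eD] := boolP (e \in D); last by rewrite zD ?y0.
  by have := ratio_le1 e eD; rewrite mulrC ler_pdivrMr ?mul1r //; rewrite inE in eD.
move=> eD0; pose w e := (y e)^-1 * z e.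
have [e1 e1D e1max] : exists2 e1, e1 \in D & forall e, e \in D -> w e <= w e1.
  by case: (@arg_maxP _ _ _ e (mem D) w eD0) => e1; exists e1.
apply: le_trans (e1max _ eD0) _; rewrite leNgt; apply/negP => s1.
pose F := [set e in D | w e < w e1].
(* Otherwise an exchange brings in [e'] for some [f] outside [F]. Optimality gives [w f <= w e'],
   but [f] attains the maximal ratio and [e'] does not. *)
have spF T e' : mu T != 0 -> e' \in F -> conn (T :&: F) (ends e').1 (ends e').2.
  move=> mT e'F; apply/negPn/negP => ne'; have /andP[sT TD] := muT T mT.
  have [f [fT fF e'T sT']] := spanning_tree_exchange sT e'F ne'.
  have fD := subsetP TD _ fT; have e'D : e' \in D by move: e'F; rewrite inE => /andP[].
  have QT' : Q (e' |: (T :\ f)).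
    rewrite /Q sT' subUset sub1set e'D /=; apply: subset_trans TD; exact: subsetDl.
  have : w f <= w e'.
    apply: (minimizer_no_swap muP mumin mT e'T fT _ QT'); rewrite ?invr_gt0.
    - exact: muT.
    - by rewrite inE in e'D.
    - by rewrite inE in fD.
  move: fF e'F; rewrite !inE; rewrite inE in fD; rewrite fD /= -leNgt => h /andP[_ h'] h''.
  by have := le_lt_trans (le_trans h h'') h'; rewrite ltxx.
(* The tree comparison averaged over both distributions, [lam] for [x] and [mu] for [z]. *)
have zF : \sum_(e in ~: F) z e <= \sum_(e in crossing F) x e.
  have /in_STP[lam [lam0 lamQ lam1] xE] := xST.
  under [X in _ <= X]eq_bigr => e' _ do rewrite xE.
  rewrite !marginal_sum -[X in X <= _]mul1r -[X in X * _ <= _]lam1 mulr_suml; apply: ler_sum => T1 _.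
  have [sT1|/lamQ->] := boolP (spanning_tree ends T1); last by rewrite !mul0r.
  apply: ler_wpM2l => //; rewrite -[X in _ <= X]mul1r -[X in _ <= X * _]mu1 mulr_suml.
  apply: ler_sum => T _; have [->|mT] := eqVneq (mu T) 0; first by rewrite !mul0r.
  apply: ler_wpM2l => //; rewrite ler_nat.
  by apply: spanning_tree_card_setD => // [|e']; [case/andP: (muT T mT) | apply: spF].
have xF : \sum_(e in crossing F) x e <= \sum_(e in crossing F) y e.
  by rewrite -(ler_pM2l (ltr0n R 2)) -!sum_comp_cuts; apply: ler_sum.
have yF : \sum_(e in crossing F) y e <= \sum_(e in ~: F) y e.
  rewrite [X in X <= _]big_mkcond [X in _ <= X]big_mkcond.
  apply: ler_sum => e' _; have [h|h] := boolP (e' \in crossing F); last by case: ifP.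
  by rewrite ifT // inE; apply: contraTN h => h; rewrite inE negbK; apply: conn_edge.
have zE : \sum_(e in ~: F) z e = w e1 * \sum_(e in ~: F) y e.
  rewrite mulr_sumr; apply: eq_bigr => e'; rewrite inE.
  have [e'D|e'D] := boolP (e' \in D); last by rewrite zD ?yD ?mulr0.
  rewrite inE e'D /= -leNgt => h.
  have <- : w e' = w e1 by apply/le_anti; rewrite h e1max.
  by rewrite /w mulrAC mulVf ?mul1r //; rewrite inE in e'D; rewrite gt_eqF.
have ypos : 0 < \sum_(e in ~: F) y e.
  rewrite (bigD1 e1) /=; last by rewrite !inE ltxx andbF.
  by rewrite ltr_pwDl ?sumr_ge0 //; rewrite inE in e1D.
move: (le_trans zF (le_trans xF yF)); rewrite zE ger_pMl //.
by apply/negP; rewrite -ltNge.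
Qed.

End CutDomination.

(** * Expectations over a random set with independent inclusions *)

Section RandomSubset.
Variables (R : realType) (E : finType).
Implicit Types (S : {set E}) (alpha g : E -> R).

(** Independence: the mean of a product over included edges factorises, by expanding the product of
    sums over subsets. *)
Lemma incl_prob_prod alpha g :
  \sum_S incl_prob alpha S * \prod_(e in S) g e =
  \prod_e (1 - alpha e + alpha e * g e).
Proof.
under [RHS]eq_bigr => e _ do rewrite addrC.
rewrite bigA_distr; apply: eq_bigr => S _; rewrite /incl_prob.
rewrite !(big_mkcond (fun e => e \in _)) -!big_split /=; apply: eq_bigr => e _.
by rewrite inE; case: (e \in S); rewrite /= ?mulr1 ?mul1r.
Qed.

Lemma incl_prob_sum1 alpha : \sum_S incl_prob alpha S = 1.
Proof.
have := incl_prob_prod alpha (fun=> 1); rewrite [RHS]big1 => [<-|e _].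
  by apply: eq_bigr => S _; rewrite big1 ?mulr1.
by rewrite mulr1 subrK.
Qed.

Lemma incl_prob_ge0 alpha S : (forall e, 0 <= alpha e <= 1) ->
  0 <= incl_prob alpha S.
Proof.
move=> a01; apply: mulr_ge0; apply: prodr_ge0 => e _.
  by case/andP: (a01 e).
by rewrite subr_ge0; case/andP: (a01 e).
Qed.

(** Markov's inequality: [h] is at least 1 wherever [P] fails, so its mean bounds the failure
    probability. *)
Lemma Pr_sub_ge alpha (P : {set E} -> Prop) (h : {set E} -> R) :
  (forall e, 0 <= alpha e <= 1) -> (forall S, 0 <= h S) ->
  (forall S, h S < 1 -> P S) ->
  1 - \sum_S incl_prob alpha S * h S <= Pr_sub alpha P.
Proof.
move=> a01 h0 hP; rewrite -(incl_prob_sum1 alpha) -sumrB /Pr_sub [X in _ <= X]big_mkcond.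
apply: ler_sum => S _; have p0 := incl_prob_ge0 S a01.
rewrite -[X in X - _]mulr1 -mulrBr; case: asboolP => PS.
  by rewrite ler_piMr // lerBlDr lerDl.
apply: mulr_ge0_le0 => //; rewrite subr_le0 leNgt; apply/negP => /hP; exact: PS.
Qed.

(** From [expR u * (1 - u) <= 1], taken at [s] for nonpositive [s] and squared at [s / 2] for
    positive [s]. *)
Lemma expR_le_quadratic (s : R) : s <= 3^-1 -> expR s <= 1 + s + s ^+ 2.
Proof.
move=> s3.
have expM (u : R) : expR u * (1 - u) <= 1.
  have := expR_ge1Dx (- u); rewrite -(ler_pM2l (expR_gt0 u)).
  by rewrite -expRD subrr expR0.
have [s0|s0] := leP s 0.
  have h : 0 < 1 - s by lra.
  rewrite -(ler_pM2r h); apply: le_trans (expM s) _.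
  have -> : (1 + s + s ^+ 2) * (1 - s) = 1 + s ^+ 2 * (- s) by ring.
  by rewrite lerDl mulr_ge0 ?sqr_ge0 // oppr_ge0.
have h : 0 < 1 - s / 2 by lra.
rewrite [s in expR s]splitr expRD -(ler_pM2r (mulr_gt0 h h)) mulrACA.
apply: le_trans (_ : 1 <= _).
  by apply: mulr_ile1 => //; rewrite mulr_ge0 ?expR_ge0 // ltW.
have -> : (1 + s + s ^+ 2) * ((1 - s / 2) * (1 - s / 2))
  = 1 + s ^+ 2 * (4^-1 * (1 - 3 * s + s ^+ 2)) by field.
rewrite lerDl mulr_ge0 ?sqr_ge0 // mulr_ge0 // addr_ge0 ?sqr_ge0 //; lra.
Qed.

(** * Chernoff bounds for the sampled weights *)

Section Chernoff.
Variables (K : R) (x : E -> R).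
Hypotheses (K0 : 0 <= K) (x0 : forall e, 0 <= x e).

Definition sampling_prob (e : E) : R := Num.min 1 (K * x e).

(* An edge kept with probability [sampling_prob e] is reweighted so that its expected
   weight is [K * x e]. *)
Definition sample_weight (e : E) : R := Num.max 1 (K * x e).

Lemma sampling_prob_itv e : 0 <= sampling_prob e <= 1.
Proof. by rewrite le_min ler01 mulr_ge0 //= ge_min lexx. Qed.

(** If [K * x e] is at least 1 the edge is kept surely and contributes no randomness. Otherwise its
    weight is 1, and the quadratic bound on [expR] applies at [t * c]. *)
Lemma sample_mgf_edge (t c : R) e : t <= 3^-1 -> 0 <= c <= 1 ->
  1 - sampling_prob e + sampling_prob e * expR (t * (c * sample_weight e)) <=
  expR ((t + t ^+ 2) * K * (c * x e)).
Proof.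
move=> t3 /andP[c0 c1]; rewrite /sampling_prob /sample_weight.
have [Kx|Kx] := leP 1 (K * x e).
  rewrite subrr add0r mul1r ler_expR -subr_ge0.
  have -> : (t + t ^+ 2) * K * (c * x e) - t * (c * (K * x e))
    = t ^+ 2 * (c * (K * x e)) by ring.
  by apply: mulr_ge0; rewrite ?sqr_ge0 // !mulr_ge0.
have Kx0 : 0 <= K * x e by rewrite mulr_ge0.
apply: le_trans (expR_ge1Dx _); rewrite mulr1.
have -> : 1 - K * x e + K * x e * expR (t * c) =
  1 + K * x e * (expR (t * c) - 1) by ring.
have -> : (t + t ^+ 2) * K * (c * x e) = K * x e * (c * (t + t ^+ 2)) by ring.
rewrite lerD2l ler_wpM2l // lerBlDl.
have tc : t * c <= 3^-1.
  have [t0|t0] := leP t 0; first by rewrite (le_trans (mulr_le0_ge0 t0 c0)).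
  by apply: le_trans t3; rewrite ler_piMr // ltW.
apply: le_trans (expR_le_quadratic tc) _.
rewrite -addrA lerD2l mulrDr mulrC lerD2l exprMn ler_wpM2r ?sqr_ge0 //.
by rewrite expr2 ler_piMr.
Qed.

Lemma sample_mgf (t : R) (a : E -> R) : t <= 3^-1 -> (forall e, 0 <= a e <= 1) ->
  \sum_S incl_prob sampling_prob S * expR (t * \sum_(e in S) a e * sample_weight e) <=
  expR ((t + t ^+ 2) * K * \sum_e a e * x e).
Proof.
move=> t3 a01.
under eq_bigr => S _ do rewrite mulr_sumr expR_sum.
rewrite incl_prob_prod mulr_sumr expR_sum; apply: ler_prod => e _.
rewrite sample_mgf_edge // andbT; case/andP: (sampling_prob_itv e) => p0 p1.
by rewrite addr_ge0 ?subr_ge0 // mulr_ge0 ?expR_ge0.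
Qed.

(** The rate comes from [t + t^2 - t (1 + eps) = - eps^2 / 4] at [t = eps / 2]. It involves [B] and
    not the mean, so rows of small mean are covered too. *)
Lemma sample_upper_tail (eps B : R) (a : E -> R) :
  0 <= eps -> eps <= 2^-1 -> (forall e, 0 <= a e <= 1) ->
  \sum_e a e * x e <= B ->
  \sum_S incl_prob sampling_prob S *
    expR (eps / 2 * (\sum_(e in S) a e * sample_weight e - (1 + eps) * K * B))
  <= expR (- (eps ^+ 2 / 4 * K * B)).
Proof.
move=> e0 e2 a01 aB; set t := eps / 2.
under eq_bigr => S _ do rewrite mulrBr expRD mulrA.
rewrite -mulr_suml.
have t3 : t <= 3^-1 by rewrite /t; lra.
apply: le_trans (ler_wpM2r (expR_ge0 _) (sample_mgf t3 a01)) _.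
rewrite -expRD ler_expR -subr_ge0.
have -> : - (eps ^+ 2 / 4 * K * B) - ((t + t ^+ 2) * K * (\sum_e a e * x e) - t * ((1 + eps) * K * B))
  = (t + t ^+ 2) * K * (B - \sum_e a e * x e) by rewrite /t; field.
have t0 : 0 <= t by rewrite divr_ge0.
by rewrite mulr_ge0 ?subr_ge0 // mulr_ge0 // addr_ge0 // sqr_ge0.
Qed.

(** At [t = - eps / 4] one has [t + t^2 - t (1 - eps / 2) = - eps^2 / 16]. *)
Lemma sample_lower_tail (eps : R) (a : E -> R) :
  0 <= eps -> (forall e, 0 <= a e <= 1) ->
  \sum_S incl_prob sampling_prob S *
    expR (- (eps / 4) * (\sum_(e in S) a e * sample_weight e
                         - (1 - eps / 2) * K * \sum_e a e * x e))
  <= expR (- (eps ^+ 2 / 16 * K * \sum_e a e * x e)).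
Proof.
move=> e0 a01; set t := - (eps / 4).
under eq_bigr => S _ do rewrite mulrBr expRD mulrA.
rewrite -mulr_suml.
have t3 : t <= 3^-1 by rewrite /t; lra.
apply: le_trans (ler_wpM2r (expR_ge0 _) (sample_mgf t3 a01)) _.
rewrite -expRD ler_expR le_eqVlt; apply/orP; left; apply/eqP.
by rewrite /t; field.
Qed.

End Chernoff.
End RandomSubset.

(** * Summing exponential bounds over all cuts *)

Section CutSum.
Variables (R : realType) (V E : finType) (ends : E -> V * V).

(** The tangent of [expR] at the mean [m] lies below the graph, and averaging it gives [expR m]. *)
Lemma expR_jensen (I : finType) (lam y : I -> R) :
  (forall i, 0 <= lam i) -> \sum_i lam i = 1 ->
  expR (\sum_i lam i * y i) <= \sum_i lam i * expR (y i).
Proof.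
move=> lam0 lam1; set m := \sum_i lam i * y i.
have -> : expR m = \sum_i lam i * (expR m * (1 + (y i - m))).
  have -> : \sum_i lam i * (expR m * (1 + (y i - m)))
    = \sum_i (expR m * ((1 - m) * lam i) + expR m * (lam i * y i)).
    by apply: eq_bigr => i _; ring.
  by rewrite big_split /= -!mulr_sumr lam1 -/m; ring.
apply: ler_sum => i _; apply: ler_wpM2l => //.
have -> : expR (y i) = expR m * expR (y i - m) by rewrite -expRD addrC subrK.
by rewrite ler_pM2l ?expR_gt0 // expR_ge1Dx.
Qed.

Lemma sum_subsets_exp (q : R) : \sum_(F : {set E}) q ^+ #|F| = (1 + q) ^+ #|E|.
Proof.
rewrite -prodr_const addrC bigA_distr; apply: eq_bigr => F _.
by rewrite -big_mkcond /= prodr_const.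
Qed.

(** Distinct nonempty [U] avoiding [r] leave distinct nonempty traces on [T], so the sum is at most
    that over all nonempty edge sets. *)
Lemma sum_tree_cuts (q : R) (T : {set E}) r : 0 <= q -> connectedT ends T ->
  \sum_(U : {set V} | (r \notin U) && (U != set0)) q ^+ #|T :&: edge_cut ends U| <=
  (1 + q) ^+ #|E| - 1.
Proof.
move=> q0 cT; pose P := [set U : {set V} | (r \notin U) && (U != set0)].
pose h U := T :&: edge_cut ends U.
have h0 : h set0 = set0 by apply/setP => e; rewrite !inE andbF.
have injh : {in P &, injective h}.
  move=> U1 U2; rewrite !inE => /andP[r1 _] /andP[r2 _].
  exact: cut_cap_inj cT r1 r2.
have hP F : F \in h @: P -> F != set0.
  case/imsetP=> U; rewrite inE => /andP[rU U0] ->; rewrite -h0.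
  by apply: contraNneq U0 => /(cut_cap_inj cT rU)->; rewrite // inE.
rewrite -sum_subsets_exp [X in _ <= X - _](bigD1 set0) //= cards0 expr0 addrC addrK.
have -> : \sum_(U : {set V} | (r \notin U) && (U != set0)) q ^+ #|T :&: edge_cut ends U|
  = \sum_(F in h @: P) q ^+ #|F|.
  by rewrite big_imset //=; apply: eq_bigl => U; rewrite inE.
rewrite [X in X <= _]big_mkcond [X in _ <= X]big_mkcond; apply: ler_sum => F _.
by case: ifP => [/hP->//|_]; case: ifP => // _; apply: exprn_ge0.
Qed.

(* By Jensen each term is at most its average over random trees, for which the
   cuts are counted by their traces on the tree. *)
Lemma sum_cuts_exp (x : E -> R) (c : R) r : in_ST ends x ->
  \sum_(U : {set V} | (r \notin U) && (U != set0))
     expR (- (c * \sum_(e in edge_cut ends U) x e)) <=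
  (1 + expR (- c)) ^+ #|E| - 1.
Proof.
move=> /in_STP[lam [lam0 lamQ lam1] xE].
have le U : expR (- (c * \sum_(e in edge_cut ends U) x e)) <=
    \sum_T lam T * expR (- c) ^+ #|T :&: edge_cut ends U|.
  under eq_bigr => e _ do rewrite xE.
  rewrite marginal_sum -mulNr mulr_sumr.
  under eq_bigr => T _ do rewrite mulrCA.
  apply: le_trans (expR_jensen _ lam0 lam1) _.
  by apply: ler_sum => T _; rewrite expRM_natr.
apply: le_trans (ler_sum _ (fun U _ => le U)) _.
rewrite exchange_big -[X in _ <= X]mul1r -[X in _ <= X * _]lam1 mulr_suml.
apply: ler_sum => T _; rewrite -mulr_sumr.
have [/andP[cT _]|/lamQ->] := boolP (spanning_tree ends T); last by rewrite !mul0r.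
by apply: ler_wpM2l => //; apply: sum_tree_cuts => //; apply: expR_ge0.
Qed.

Lemma in_ST_sum_le (x : E -> R) : in_ST ends x -> \sum_e x e <= #|V|%:R.
Proof.
move=> /in_STP[lam [lam0 lamQ lam1] xE].
have -> : \sum_e x e = \sum_(e in setT) marginal (@Defs.indic E R) lam e.
  by apply: eq_big => [e|e _]; rewrite ?inE ?xE.
rewrite marginal_sum -[X in _ <= X]mul1r -[X in _ <= X * _]lam1 mulr_suml.
apply: ler_sum => T _; rewrite setIT.
have [/andP[_ aT]|/lamQ->] := boolP (spanning_tree ends T); last by rewrite !mul0r.
by rewrite ler_wpM2l // ler_nat (forest_card_leV aT).
Qed.

End CutSum.

(** * From good samples to a polytope point, and numerical estimates *)

Section Sampling.
Variables (R : realType) (V E : finType) (ends : E -> V * V).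

Lemma sampled_in_ST (K eps : R) (x : E -> R) (S : {set E}) (r : V) k
    (A : 'I_k -> E -> R) (b : 'I_k -> R) :
  0 < K -> 0 < eps -> eps <= 2^-1 -> in_ST ends x ->
  (forall i e, 0 <= A i e) -> (forall i, 0 <= b i) ->
  (forall i, \sum_(e in S) A i e * sample_weight K x e <= (1 + eps) * K * b i) ->
  (forall U : {set V}, r \notin U -> U != set0 ->
     (1 - eps / 2) * K * (\sum_e (e \in edge_cut ends U)%:R * x e) <=
     \sum_(e in S) (e \in edge_cut ends U)%:R * sample_weight K x e) ->
  exists z, [/\ in_ST ends z, forall e, e \notin S -> z e = 0 &
    forall i, \sum_e A i e * z e <= (1 + 3 * eps) * b i].
Proof.
move=> K0 e0 e2 xST A0 b0 rows cuts.
have d0 : 0 < 1 - eps / 2 by lra.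
pose M := (1 - eps / 2) * K; have M0 : 0 < M by rewrite mulr_gt0.
(* The sampled weights are divided by [M] so that the cut hypothesis says exactly that [y] dominates
   [x]. *)
pose y e := (e \in S)%:R * sample_weight K x e / M.
have sumM (a : E -> R) :
    \sum_(e in S) a e * sample_weight K x e = (\sum_e a e * y e) * M.
  rewrite big_mkcond mulr_suml; apply: eq_bigr => e _; rewrite /y.
  by case: (e \in S); rewrite !(mul1r, mul0r, mulr0) // mulrA divfK ?gt_eqF.
have y0 e : 0 <= y e.
  rewrite divr_ge0 ?(ltW M0) // mulr_ge0 ?ler0n // le_max ler01 //.
have cutE U (g : E -> R) :
    \sum_e (e \in edge_cut ends U)%:R * g e = \sum_(e in edge_cut ends U) g e.
  rewrite [RHS]big_mkcond; apply: eq_bigr => e _.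
  by case: (_ \in _); rewrite ?mul1r ?mul0r.
have xy (U : {set V}) : r \notin U ->
    \sum_(e in edge_cut ends U) x e <= \sum_(e in edge_cut ends U) y e.
  move=> rU; have [->|U0] := eqVneq U set0.
    by rewrite !big_pred0 // => e; rewrite !inE.
  by have := cuts U rU U0; rewrite sumM !cutE mulrC ler_pM2r.
have [U|z zST zy] := cut_dominated_in_ST xST y0 _.
  (* A set containing [r] is replaced by its complement, which has the same cut. *)
  have [rU|/xy//] := boolP (r \in U).
  have -> : edge_cut ends U = edge_cut ends (~: U).
    by apply/setP => e; rewrite !inE; do 2!case: (_ \in U).
  by apply: xy; rewrite inE negbK.
exists z; split=> // [e eS|i].
  apply/eqP; rewrite eq_le (in_ST_ge0 _ zST) andbT.
  by apply: le_trans (zy e) _; rewrite /y (negPf eS) !mul0r.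
apply: le_trans (_ : \sum_e A i e * y e <= _).
  by apply: ler_sum => e _; apply: ler_wpM2l.
rewrite -(ler_pM2r M0) -sumM; apply: le_trans (rows i) _.
have -> : (1 + 3 * eps) * b i * M = ((1 + 3 * eps) * (1 - eps / 2)) * K * b i.
  by rewrite /M; ring.
rewrite ler_wpM2r // ler_pM2r // -subr_ge0.
have -> : (1 + 3 * eps) * (1 - eps / 2) - (1 + eps) = 3 / 2 * eps * (1 - eps).
  by field.
by rewrite !mulr_ge0 //; lra.
Qed.

Lemma expR_ln_nat_le (N : nat) (u : R) : (0 < N)%N -> 2 <= u ->
  expR (- (u * ln N%:R)) <= N%:R^-2.
Proof.
move=> N0 u2; have l0 : 0 <= ln (N%:R : R) by rewrite ln_ge0 // ler1n.
apply: le_trans (_ : expR (- (2 * ln N%:R)) <= _).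
  by rewrite ler_expR lerN2 ler_wpM2r.
by rewrite expRN expRM_natl lnK // posrE ltr0n.
Qed.

(** The power is at most [expR (m q)] with [m q <= 1/N <= 1/3], and the quadratic bound leaves at
    most [2 m q]. *)
Lemma exprn_1D_le (N m : nat) (q : R) : (3 <= N)%N -> (m <= N)%N -> 0 <= q ->
  q <= N%:R^-2 -> (1 + q) ^+ m - 1 <= 2 / N%:R.
Proof.
move=> N3 mN q0 qN; have N0 : 0 < N%:R :> R by rewrite ltr0n; apply: leq_trans N3.
have mq : m%:R * q <= N%:R^-1.
  apply: le_trans (_ : N%:R * N%:R^-2 <= _).
    by apply: ler_pM; rewrite ?ler0n ?ler_nat.
  by rewrite expr2 invfM mulVKf ?gt_eqF.
have N3' : N%:R^-1 <= 3^-1 :> R by rewrite lef_pV2 ?posrE // ler_nat.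
have mq0 : 0 <= m%:R * q by rewrite mulr_ge0.
have : (1 + q) ^+ m <= expR (m%:R * q).
  by rewrite expRM_natl; apply: lerXn2r; rewrite ?nnegrE ?addr_ge0 ?expR_ge0 ?expR_ge1Dx.
move=> /le_trans/(_ (expR_le_quadratic (le_trans mq N3'))).
have : (m%:R * q) ^+ 2 <= m%:R * q by rewrite expr2 ler_piMr //; lra.
by lra.
Qed.

End Sampling.

(** * Combination of the tail bounds and choice of constants *)

Theorem theorem1p4 (R : realType) :
  exists (C C0 : R) (c : nat), [/\ 0 < C, 0 < C0, (0 < c)%N &
  forall (V E : finType) (ends : E -> V * V) (eps : R) (x : E -> R)
         (k : nat) (A : 'I_k -> E -> R) (b : 'I_k -> R),
    0 < eps -> eps <= 2^-1 ->
    in_ST ends x ->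
    (forall e, exists q : rat, x e = ratr q) ->
    (forall i e, 0 <= A i e <= 1) ->
    (forall i, 1 <= b i) ->
    (forall i, \sum_(e : E) A i e * x e <= b i) ->
    let N := (k + #|E|)%N in
    let alpha := fun e => Num.min 1 (36 * ln N%:R / eps ^+ 2 * x e) in
    Pr_sub alpha (fun E' : {set E} =>
        #|E'|%:R <= C * #|V|%:R * ln N%:R / eps ^+ 2 /\
        exists z : E -> R, [/\ in_ST ends z,
           (forall e, e \notin E' -> z e = 0) &
           forall i, \sum_(e : E) A i e * z e <= (1 + 3 * eps) * b i])
      >= 1 - C0 / N%:R ^+ c].
Proof.
(* 54 is 36 times 3/2, the largest value of [1 + eps]. The 4 collects 1 for the rows, 1 for the size
   and 2 for the cuts. *)
exists 54, 4, 1%N; split=> // V E ends eps x k A b e0 e2 xST _ A01 b1 Axb.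
cbv zeta; rewrite expr1; set N := (k + #|E|)%N.
set alpha := fun e : E => Num.min 1 _; set P := fun E' : {set E} => _.
have x0 e : 0 <= x e by apply: in_ST_ge0 xST.
have lN0 : 0 <= ln (N%:R : R).
  by case: (N) => [|n]; [rewrite ln0 | rewrite ln_ge0 // ler1n].
pose K := 36 * ln N%:R / eps ^+ 2.
have K0 : 0 <= K by rewrite divr_ge0 ?sqr_ge0 // mulr_ge0.
have alpha01 e : 0 <= alpha e <= 1 by exact: (sampling_prob_itv K0 x0).
(* Without edges [x] itself serves as [z]; otherwise an end of [e1] supplies the root [r] avoided by
   the cuts. *)
have [e1 _|E0] := pickP (predT : pred E); last first.
  apply: le_trans (_ : 1 <= _); first by rewrite lerBlDr lerDl divr_ge0.
  have E00 (F : {set E}) : #|F| = 0%N by apply: eq_card0 => e; have := E0 e.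
  rewrite -[X in X <= _](incl_prob_sum1 alpha) /Pr_sub [X in _ <= X]big_mkcond.
  apply: ler_sum => S _; case: asboolP => // -[]; split.
    by rewrite E00 divr_ge0 ?sqr_ge0 // !mulr_ge0.
  exists x; split=> // [e|i]; first by have := E0 e.
  rewrite big1 => [|e]; last by have := E0 e.
  by rewrite mulr_ge0 ?(le_trans ler01 (b1 i)) //; lra.
(* For [N] at most 3 the claimed lower bound is not positive. *)
have [N3|N3] := leqP N 3.
  apply: le_trans (_ : 0 <= _); last first.
    by apply: sumr_ge0 => S _; apply: incl_prob_ge0.
  have Npos : (0 < N)%N by rewrite addn_gt0 orbC (cardD1 e1).
  rewrite subr_le0 ler_pdivlMr ?ltr0n // mul1r (ler_nat _ N 4).
  exact: leq_trans N3 _.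
have Npos : (0 < N)%N by apply: leq_trans N3.
have NR : 0 < N%:R :> R by rewrite ltr0n.
have l0 : 0 < ln (N%:R : R) by rewrite ln_gt0 // ltr1n; apply: leq_trans N3.
have Kpos : 0 < K by rewrite divr_gt0 ?exprn_gt0 // mulr_gt0.
have Keps (u : R) : u != 0 -> eps ^+ 2 / u * K = 36 / u * ln N%:R.
  by move=> u0; rewrite /K; field; rewrite u0 gt_eqF.
pose r := (ends e1).1.
have V1 : 1 <= #|V|%:R :> R by rewrite ler1n (cardD1 r).
pose w := sample_weight K x.
pose ind U e : R := (e \in edge_cut ends U)%:R.
have ind01 U e : 0 <= ind U e <= 1 by rewrite ler0n lern1 leq_b1.
pose tail (a : E -> R) B (S : {set E}) : R :=
  expR (eps / 2 * (\sum_(e in S) a e * w e - (1 + eps) * K * B)).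
pose cut_tail U (S : {set E}) : R :=
  expR (- (eps / 4) * (\sum_(e in S) ind U e * w e
                       - (1 - eps / 2) * K * \sum_e ind U e * x e)).
pose Pcut (U : {set V}) := (r \notin U) && (U != set0).
(* All terms are nonnegative, so [h S < 1] forces every single tail below 1, that is, every desired
   inequality at once. *)
pose h S := \sum_i tail (A i) (b i) S + tail (fun=> 1) #|V|%:R S
            + \sum_(U | Pcut U) cut_tail U S.
have h0 S : [/\ 0 <= \sum_i tail (A i) (b i) S, 0 <= tail (fun=> 1) #|V|%:R S
              & 0 <= \sum_(U | Pcut U) cut_tail U S].
  by split; rewrite ?sumr_ge0 // => *; apply: expR_ge0.
have tail_lt1 a B S : tail a B S < 1 ->
    \sum_(e in S) a e * w e <= (1 + eps) * K * B.
  by rewrite expR_lt1 pmulr_rlt0 ?divr_gt0 // subr_lt0 => /ltW.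
have hP S : h S < 1 -> P S.
  have [s1 s2 s3] := h0 S; move=> h1.
  have rows i : tail (A i) (b i) S < 1.
    apply: le_lt_trans h1; rewrite /h (bigD1 i) //= -!addrA lerDl.
    by rewrite !addr_ge0 // sumr_ge0 // => *; apply: expR_ge0.
  have size : tail (fun=> 1) #|V|%:R S < 1.
    by apply: le_lt_trans h1; rewrite /h addrAC lerDr addr_ge0.
  have cuts U : Pcut U -> cut_tail U S < 1.
    move=> PU; apply: le_lt_trans h1; rewrite /h (bigD1 U) //= addrCA lerDl.
    by rewrite !addr_ge0 // sumr_ge0 // => *; apply: expR_ge0.
  split.
    (* Each sampled edge has weight at least 1, so the total weight bounds the number of edges. *)
    apply: le_trans (_ : \sum_(e in S) 1 * w e <= _).
      rewrite -sum1_card natr_sum; apply: ler_sum => e _.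
      by rewrite mul1r le_max lexx.
    apply: le_trans (tail_lt1 _ _ _ size) _.
    have -> : 54 * #|V|%:R * ln N%:R / eps ^+ 2 = (1 + 2^-1) * K * #|V|%:R.
      by rewrite /K; field; rewrite gt_eqF.
    by rewrite ler_wpM2r // ler_pM2r // lerD2l.
  apply: (@sampled_in_ST _ _ _ ends K eps x S r) => //.
  - by move=> i e; case/andP: (A01 i e).
  - by move=> i; apply: le_trans (b1 i).
  - by move=> i; apply: tail_lt1.
  - move=> U rU U0; have /cuts : Pcut U by rewrite /Pcut rU.
    by rewrite expR_lt1 nmulr_rlt0 ?oppr_lt0 ?divr_gt0 // subr_gt0 => /ltW.
apply: le_trans (Pr_sub_ge alpha01 _ hP); last first.
  by move=> S; have [] := h0 S; move=> *; rewrite !addr_ge0.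
rewrite lerD2l lerN2.
(* The exponent is [9 * B * ln N] with [B] at least 1, well beyond the required [2 * ln N]. *)
have Etail (a : E -> R) B : (forall e, 0 <= a e <= 1) -> 1 <= B ->
    \sum_e a e * x e <= B -> \sum_S incl_prob alpha S * tail a B S <= N%:R^-2.
  move=> a01 B1 aB; apply: le_trans (sample_upper_tail K0 x0 (ltW e0) e2 a01 aB) _.
  rewrite Keps // mulrAC; apply: expR_ln_nat_le => //.
  by lra.
(* The rate [36 / 16 = 9 / 4] still exceeds 2, as the estimate of the power of [1 + q] requires. *)
have Ecuts : \sum_(U | Pcut U) \sum_S incl_prob alpha S * cut_tail U S <= 2 / N%:R.
  apply: le_trans (_ : \sum_(U | Pcut U)
      expR (- ((36 / 16 * ln N%:R) * \sum_(e in edge_cut ends U) x e)) <= _).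
    apply: ler_sum => U _.
    apply: le_trans (sample_lower_tail K0 x0 (ltW e0) (ind01 U)) _.
    rewrite Keps // ler_expR lerN2 le_eqVlt; apply/orP; left; apply/eqP.
    congr (_ * _); rewrite [LHS]big_mkcond; apply: eq_bigr => e _.
    by rewrite /ind; case: (_ \in _); rewrite ?mul1r ?mul0r.
  apply: le_trans (sum_cuts_exp _ _ xST) _.
  apply: exprn_1D_le; rewrite ?leq_addl ?expR_ge0 //; first exact: ltnW.
  by apply: expR_ln_nat_le => //; lra.
rewrite /h; under eq_bigr => S _ do rewrite !mulrDr !mulr_sumr.
rewrite !big_split /= exchange_big [X in _ + X]exchange_big /=.
have Esize : \sum_S incl_prob alpha S * tail (fun=> 1) #|V|%:R S <= N%:R^-2.
  apply: Etail => // [e|]; first by rewrite ler01 lexx.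
  by under eq_bigr => e _ do rewrite mul1r; apply: in_ST_sum_le xST.
have Erows : \sum_i \sum_S incl_prob alpha S * tail (A i) (b i) S <= k%:R * N%:R^-2.
  rewrite -[k in k%:R]card_ord mulr_natl -sumr_const; apply: ler_sum => i _.
  by apply: Etail.
have kN : k%:R * N%:R^-2 <= N%:R^-1 :> R.
  apply: le_trans (_ : N%:R * N%:R^-2 <= _).
    by rewrite ler_wpM2r ?ler_nat ?leq_addr // invr_ge0 sqr_ge0.
  by rewrite expr2 invfM mulVKf ?gt_eqF.
have N1 : N%:R^-2 <= N%:R^-1 :> R.
  rewrite lef_pV2 ?posrE ?exprn_gt0 // expr2 ler_peMr ?ltW // ltr1n.
  exact: leq_trans N3.
have -> : 4 / N%:R = N%:R^-1 + N%:R^-1 + 2 / N%:R :> R by ring.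
apply: lerD Ecuts; apply: lerD; last exact: le_trans Esize N1.
exact: le_trans Erows kN.
Qed.
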